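(* Let $M_{\mathcal{B}}$ be a canonical rational multicyclic monoid and let $x$ be a nonzero element of $M_{\mathcal{B}}$. Then the following statements hold: (1) $\mathsf{L}(x)$ is the union of finitely many multidimensional arithmetic progressions. Furthermore, $|\mathsf{L}(x)| = \infty$ if and only if $\mathsf{n}(b)\,b^l$ divides $x$ in $M_{\mathcal{B}}$ for some $b \in \mathcal{B}$ with $b < 1$ and some $l \in \mathbb{N}_0$. (2) If $|\mathsf{n}(b) - \mathsf{d}(b)| = |\mathsf{n}(b') - \mathsf{d}(b')|$ for all $b, b' \in \mathcal{B}$, then $\mathsf{L}(x)$ is an arithmetic progression.
   Context: $\mathbb{N}$ and $\mathbb{N}_0$ are the positive and nonnegative integers. For $q \in \mathbb{Q}_{>0}$, $\mathsf{n}(q)$ and $\mathsf{d}(q)$ are the relatively prime positive integers with $q = \mathsf{n}(q)/\mathsf{d}(q)$. A unit fraction is a number $1/m$ with $m \in \mathbb{N}$, $m>1$. For a finite subset $\mathcal{B} \subseteq \mathbb{Q}_{>0}$, let $M_{\mathcal{B}}$ be the additive submonoid of $\mathbb{Q}_{\geq 0}$ generated by $\{b^k \mid b \in \mathcal{B},\, k \in \mathbb{N}_0\}$. $M_{\mathcal{B}}$ is called the rational multicyclic monoid over $\mathcal{B}$ if $M_{\mathcal{B}'} \subsetneq M_{\mathcal{B}}$ whenever $\mathcal{B}' \subsetneq \mathcal{B}$; it is assumed throughout that no element of $\mathcal{B}$ is a unit fraction. It is canonical if $\mathcal{B} \cap \mathbb{N} = \emptyset$ and $\gcd(\mathsf{d}(b),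 \mathsf{d}(b')) = 1$ for all distinct $b, b' \in \mathcal{B}$. An element $y$ divides $x$ in a monoid $M$ if $x = y + y'$ for some $y' \in M$ (with $x,y\in M$). An atom is a nonzero element of $M$ that is not a sum of two nonzero elements of $M$. A factorization of $x$ is a formal sum (element of the free commutative monoid on the set of atoms) $z = a_1 + \cdots + a_k$ of atoms whose sum in $M$ is $x$; its length is $|z| = k$. $\mathsf{L}(x)$ is the set of lengths of all factorizations of $x$. For $d \in \mathbb{N}$ and $l \in \mathbb{N}_0 \cup \{\infty\}$, set $P_l(d) := d\mathbb{Z} \cap [0, ld]$ (for $l = \infty$ this is $\{0, d, 2d, \ldots\}$). For $r\in\mathbb{N}$, a nonempty set $S \subseteq \mathbb{N}_0$ is an $r$-dimensional arithmetic progression if $S = \min S + \sum_{i=1}^{r} P_{l_i}(d_i)$ (sumset) for some $d_1, \ldots, d_r \in \mathbb{N}$ and $l_1, \ldots, l_r \in \mathbb{N}_0 \cup \{\infty\}$; it is a multidimensional arithmetic progression if this holds for some positive integer $r$. An arithmetic progression is a set of this form with $r = 1$ (finite, possibly a singleton, or infinite). *)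

(* Defs.v *)
From HB Require Import structures.
From mathcomp Require Import all_boot all_order all_algebra.
From mathcomp Require Import finmap multiset.
From mathcomp Require Import boolp classical_sets functions cardinality.

Set Implicit Arguments.
Unset Strict Implicit.
Unset Printing Implicit Defensive.

Import Order.TTheory GRing.Theory Num.Theory.

Local Open Scope classical_set_scope.
Local Open Scope ring_scope.

Definition num (q : rat) : nat := `|numq q|%N.
Definition den (q : rat) : nat := `|denq q|%N.

Definition submonoid (M : set rat) : Prop :=
  M 0 /\ (forall x y, M x -> M y -> M (x + y)).

Definition M_ (B : {fset rat}) : set rat :=
  smallest submonoid [set q | exists b k, b \in B /\ q = b ^+ k].

Definition unit_fraction (q : rat) : Prop :=
  exists m : nat, (1 < m)%N /\ q = m%:R^-1.

(* The exclusion of unit fractions is a standing convention on the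
   generating set, so it is made part of the notion. *)
Definition multicyclic (B : {fset rat}) : Prop :=
  [/\ forall b, b \in B -> 0 < b,
      forall b, b \in B -> ~ unit_fraction b
    & forall B' : {fset rat}, (B' `<` B)%fset -> M_ B' `<` M_ B].

Definition canonical_multicyclic (B : {fset rat}) : Prop :=
  [/\ multicyclic B,
      forall b, b \in B -> b \isn't a Num.nat
    & forall b b', b \in B -> b' \in B -> b != b' -> coprime (den b) (den b')].

Definition divides_in (M : set rat) (y x : rat) : Prop :=
  [/\ M y, M x & exists2 y', M y' & x = y + y'].

Definition atom (M : set rat) (a : rat) : Prop :=
  [/\ M a, a != 0 &
      ~ exists y z, [/\ M y, M z, y != 0, z != 0 & a = y + z]].

Definition factorization (M : set rat) (x : rat) (z : {mset rat}%mset) : Prop :=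
  (forall a, a \in z -> atom M a) /\ \sum_(a <- z) a = x.

Definition L_ (M : set rat) (x : rat) : set nat :=
  [set k | exists2 z : {mset rat}%mset, factorization M x z & size z = k].

(* dZ /\ [0, ld], as a subset of nat since it has no negative elements;
   [l = None] encodes l = oo. *)
Definition P_ (l : option nat) (d : nat) : set nat :=
  [set m | (d %| m)%N /\ (if l is Some k then (m <= k * d)%N else True)].

Definition minimum_of (S : set nat) (m : nat) : Prop :=
  S m /\ forall s, S s -> (m <= s)%N.

Definition multi_AP (r : nat) (S : set nat) : Prop :=
  exists (m : nat) (d : 'I_r -> nat) (l : 'I_r -> option nat),
    [/\ minimum_of S m, forall i, (0 < d i)%N &
        S = [set s | exists p : 'I_r -> nat,
               (forall i, P_ (l i) (d i) (p i)) /\ s = (m + \sum_i p i)%N]].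

Definition multidimensional_AP (S : set nat) : Prop :=
  exists r : nat, (0 < r)%N /\ multi_AP r S.

Definition arithmetic_progression (S : set nat) : Prop := multi_AP 1 S.

Definition finite_union_of (C : set nat -> Prop) (S : set nat) : Prop :=
  exists (n : nat) (A : 'I_n -> set nat),
    (forall i, C (A i)) /\ S = \bigcup_i A i.

(* Main.v *)
(* Record a sum of powers of the elements of B by one polynomial P_b with
   nonnegative integer coefficients per b, the coefficient of X^k counting the
   copies of b^k; the sum is \sum_b P_b(b) and its length is \sum_b P_b(1).
   Since the denominators are pairwise coprime, two such families with the same
   sum satisfy Q_b - P_b = N_b + (d(b) X - n(b)) E_b with integers N_b of sum 0.
   Looking at the leading coefficient of some E_b, one of the two families admits
   the exchange of d(b) copies of b^(k+1) for n(b) copies of b^k, so any two of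
   them are joined by a chain of such exchanges, each of which changes the length
   by n(b) - d(b).  If |n(b) - d(b)| = D for all b, the lengths therefore fill an
   interval of a class modulo D, which is (2) and, for a single b, the building
   block of (1): writing P_b = a_b + X Q_b, the values Q_b(b) range over a finite
   set, as b Q_b(b) is bounded by x and determined modulo 1, and for prescribed
   values the lengths of the Q_b vary independently.
   If no n(b) b^l with b < 1 divides x, then E_b = 0 for all b < 1, while the
   powers of b > 1 are at least 1, which bounds the length.  Otherwise
   n(b) b^l = n(b) b^(l+1) + (d(b) - n(b)) b^(l+1) can be expanded forever. *)
Require Import Defs.
From HB Require Import structures.
From mathcomp Require Import all_boot all_order all_algebra.
From mathcomp Require Import finmap multiset.
From mathcomp Require Import boolp classical_sets functions cardinality.
From mathcomp Require Import zify ring lra.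

Set Implicit Arguments.
Unset Strict Implicit.
Unset Printing Implicit Defensive.

Import Order.TTheory GRing.Theory Num.Theory.

Local Open Scope classical_set_scope.
Local Open Scope ring_scope.

(** * Integer polynomials at a rational number and their integral values *)

Definition evq (b : rat) (p : {poly int}) : rat := (map_poly intr p).[b].

Lemma evqD b (p q : {poly int}) : evq b (p + q) = evq b p + evq b q.
Proof. by rewrite /evq rmorphD hornerD. Qed.

Lemma evqB b (p q : {poly int}) : evq b (p - q) = evq b p - evq b q.
Proof. by rewrite /evq rmorphB hornerD hornerN. Qed.

Lemma evqM b (p q : {poly int}) : evq b (p * q) = evq b p * evq b q.
Proof. by rewrite /evq rmorphM hornerM. Qed.

Lemma evqC b c : evq b c%:P = c%:~R.
Proof. by rewrite /evq map_polyC hornerC. Qed.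

Lemma evqX b : evq b 'X = b.
Proof. by rewrite /evq map_polyX hornerX. Qed.

Lemma evqXn b k : evq b 'X^k = b ^+ k.
Proof. by rewrite /evq map_polyXn hornerXn. Qed.

(** The primitive integer polynomial with root [b]. *)
Definition lin (b : rat) : {poly int} := (denq b)%:P * 'X - (numq b)%:P.

Lemma denq_rat (b : rat) : b * (denq b)%:~R = (numq b)%:~R.
Proof. by rewrite -{1}(divq_num_den b) divfK // intr_eq0 denq_neq0. Qed.

Lemma evq_lin b : evq b (lin b) = 0.
Proof. by rewrite /lin evqB evqM !evqC evqX mulrC denq_rat subrr. Qed.

Lemma lin1 b : (lin b).[1] = denq b - numq b.
Proof. by rewrite /lin !hornerE. Qed.

Lemma coef0_linM b (E : {poly int}) : (lin b * E)`_0 = - (numq b * E`_0).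
Proof. by rewrite /lin mulrBl coefB -mulrA !coefCM coefXM mulr0 sub0r. Qed.

Lemma coefS_linM b (E : {poly int}) k :
  (lin b * E)`_k.+1 = denq b * E`_k - numq b * E`_k.+1.
Proof. by rewrite /lin mulrBl coefB -mulrA !coefCM coefXM. Qed.

Lemma evq_denq b p : exists K, evq b p * (denq b)%:~R ^+ K \is a Num.int.
Proof.
elim/poly_ind: p => [|p c [K hK]]; first by exists 0; rewrite evqC mul0r.
exists K.+1; rewrite evqD evqM evqX evqC mulrDl exprSr rpredD //; last first.
  by rewrite rpredM ?rpredX ?intr_int // rpredM ?rpredX ?intr_int.
by rewrite mulrACA denq_rat rpredM ?intr_int.
Qed.

(** Division from the constant term upwards. For [p * 'X + c], clearing denominators shows that
    [numq b] divides [N - c], being coprime to [denq b]. With quotient [q], the polynomial [p] takes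
    the integer value [q * denq b] at [b], and the induction continues. *)
Lemma evq_int_lin b p (N : int) :
  b != 0 -> evq b p = N%:~R -> exists E, p = N%:P + lin b * E.
Proof.
move=> b0; elim/poly_ind: p N => [|p c IH] N.
  by rewrite evqC => /intr_inj <-; exists 0; rewrite mulr0 addr0.
rewrite evqD evqM evqX evqC => hN.
have [K /intrP[u hu]] := evq_denq b p.
have h : u * numq b = (N - c) * denq b ^+ K.+1.
  apply: (@intr_inj rat).
  by rewrite !rmorphM /= -hu -denq_rat rmorphB /= -hN rmorphXn /= exprS; ring.
have /dvdzP[q hq] : (numq b %| N - c)%Z.
  have : (numq b %| (N - c) * denq b ^+ K.+1)%Z by rewrite -h dvdz_mull.
  rewrite Gauss_dvdzl // /coprimez; apply/eqP.
  have := coprimeXr K.+1 (coprime_num_den b).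
  by rewrite /coprime /gcdz abszX => /eqP ->.
have /IH[E hE] : evq b p = (q * denq b)%:~R.
  apply: (mulIf b0); rewrite rmorphM /= mulrAC -mulrA denq_rat -rmorphM /= -hq.
  by rewrite rmorphB /= -hN addrK.
exists (q%:P + E * 'X); rewrite hE -[N](subrK c) hq /lin polyCD !polyCM; ring.
Qed.

(** The denominator of [evq b (P b)] divides a power of [denq b] and, as the whole sum vanishes,
    also an integer coprime to [denq b]; a Bezout identity gives integrality. *)
Lemma evq_int_sum (r : seq rat) (P : rat -> {poly int}) b :
  uniq r -> (forall b b', b \in r -> b' \in r -> b != b' ->
    coprimez (denq b) (denq b')) ->
  \sum_(a <- r) evq a (P a) = 0 -> b \in r ->
  evq b (P b) \is a Num.int.
Proof.
move=> ur cop; move=> S0 br.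
have {S0} eS : evq b (P b) = - \sum_(a <- rem b r) evq a (P a).
  by apply/eqP; rewrite -addr_eq0; move: S0; rewrite (big_rem b) // => ->.
have hr : {in rem b r, forall a, coprimez (denq b) (denq a)}.
  by move=> a; rewrite mem_rem_uniq // inE => /andP[ab ar]; rewrite cop // eq_sym.
have clear_den : forall s : seq rat, {in s, forall a, coprimez (denq b) (denq a)} ->
    exists2 W : int, coprimez (denq b) W &
      (\sum_(a <- s) evq a (P a)) * W%:~R \is a Num.int.
  elim=> [|a s IH] hs.
    by exists 1; [rewrite /coprimez gcdz1 | rewrite big_nil mul0r].
  have [|W cW hW] := IH; first by move=> c cs; rewrite hs // inE cs orbT.
  have [K hK] := evq_denq a (P a).
  exists (denq a ^+ K * W).
    by rewrite coprimezMr cW coprimezXr // hs // inE eqxx.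
  rewrite big_cons rmorphM rmorphXn /= mulrDl rpredD //.
    by rewrite mulrA rpredM ?intr_int.
  by rewrite mulrCA rpredM ?rpredX ?intr_int.
have [W cW hW] := clear_den _ hr.
have [K hK] := evq_denq b (P b).
have /coprimezP[[u v] /= uv] : coprimez (denq b ^+ K) W by rewrite coprimezXl.
have -> : evq b (P b) = u%:~R * (evq b (P b) * (denq b)%:~R ^+ K)
                       + v%:~R * (evq b (P b) * W%:~R).
  rewrite -rmorphXn mulrCA [X in _ + X]mulrCA -mulrDr -!rmorphM -rmorphD /= uv.
  by rewrite mulr1.
rewrite rpredD // rpredM ?intr_int //.
by rewrite eS mulNr rpredN.
Qed.

(** * Families of polynomials and chains of exchanges *)

(** What canonicity provides: numerators exceed 1 because unit fractions are excluded, denominators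
    because integers are. Lists make the case [[:: b]] directly available. *)
Definition admissible (r : seq rat) : Prop :=
  [/\ uniq r, forall b, b \in r -> [/\ 0 < b, 1 < numq b & 1 < denq b]
    & forall b b', b \in r -> b' \in r -> b != b' ->
      coprimez (denq b) (denq b')].

Definition value (r : seq rat) (P : rat -> {poly int}) : rat :=
  \sum_(b <- r) evq b (P b).

Definition weight (r : seq rat) (P : rat -> {poly int}) : int :=
  \sum_(b <- r) (P b).[1].

(* The constant terms of the P b all count copies of 1 = b ^+ 0, so a family is
   not determined by the multiset of powers that it stands for. *)
Definition config (r : seq rat) (x : rat) (P : rat -> {poly int}) : Prop :=
  (forall b k, 0 <= (P b)`_k) /\ value r P = x.

Definition rep (r : seq rat) (x : rat) (s : int) : Prop :=
  exists2 P, config r x P & weight r P = s.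

Definition upd (P : rat -> {poly int}) b p : rat -> {poly int} :=
  fun a => if a == b then p else P a.

Lemma sum_upd (V : zmodType) r P b p (F : rat -> {poly int} -> V) :
  uniq r -> b \in r ->
  \sum_(a <- r) F a (upd P b p a) =
    \sum_(a <- r) F a (P a) + (F b p - F b (P b)).
Proof.
move=> ur br; rewrite !(big_rem b br) /= {1}/upd eqxx.
have -> : \sum_(a <- rem b r) F a (upd P b p a) = \sum_(a <- rem b r) F a (P a).
  by apply: eq_big_seq => a; rewrite mem_rem_uniq // inE /upd => /andP[/negPf->].
by rewrite [RHS]addrC addrA subrK.
Qed.

Lemma config_diff r P Q : admissible r -> value r P = value r Q ->
  exists (N : rat -> int) (E : rat -> {poly int}),
    (forall b, b \in r -> Q b = P b + (N b)%:P + lin b * E b) /\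
    \sum_(b <- r) N b = 0.
Proof.
move=> [ur rpos cop] PQ.
have D0 : \sum_(b <- r) evq b (Q b - P b) = 0.
  under eq_bigr do rewrite evqB.
  by rewrite sumrB -/(value r Q) -/(value r P) PQ subrr.
have /choice[NE hNE] : forall b, exists NE : int * {poly int},
    b \in r -> Q b - P b = NE.1%:P + lin b * NE.2.
  move=> b; case: (boolP (b \in r)) => [br|_]; last by exists (0, 0).
  have /intrP[N hN] := evq_int_sum ur cop D0 br.
  have [b0 _ _] := rpos _ br.
  by have [E hE] := evq_int_lin (lt0r_neq0 b0) hN; exists (N, E).
exists (fun b => (NE b).1), (fun b => (NE b).2); split=> [b br|].
  by rewrite -addrA -hNE // addrC subrK.
apply: (@intr_inj rat); rewrite rmorph_sum /= -[RHS]D0.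
apply: eq_big_seq => b br /=.
by rewrite hNE // evqD evqM evq_lin mul0r addr0 evqC.
Qed.

(* Subtracting 'X^k * lin b exchanges den b copies of b ^+ k.+1 for num b copies
   of b ^+ k. *)
Lemma coef_down b (p : {poly int}) k j :
  (p - 'X^k * lin b : {poly int})`_j =
    p`_j - (k.+1 == j)%:R * denq b + (k == j)%:R * numq b.
Proof.
have -> : p - 'X^k * lin b = p - 'X^(k.+1) * (denq b)%:P + 'X^k * (numq b)%:P.
  by rewrite /lin exprSr; ring.
by rewrite !(coefD, coefN, coefMC, coefXn) ![_ == j]eq_sym.
Qed.

Lemma config_down r x P b k : admissible r -> config r x P -> b \in r ->
  denq b <= (P b)`_k.+1 ->
  config r x (upd P b (P b - 'X^k * lin b)) /\
  weight r P = weight r (upd P b (P b - 'X^k * lin b)) + (denq b - numq b).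
Proof.
move=> [ur rpos _] [P0 Px] br hk.
have [_ /ltW n0 _] := rpos _ br.
split; first split.
- move=> a j; rewrite /upd; case: ifP => _; last exact: P0.
  rewrite coef_down; apply: addr_ge0; last first.
    by rewrite mulr_ge0 // (le_trans _ n0).
  have [<-|_] := eqVneq; first by rewrite mul1r subr_ge0.
  by rewrite mul0r subr0 P0.
- by rewrite /value sum_upd // evqB evqM evq_lin mulr0 subr0 subrr addr0.
- rewrite /weight (sum_upd _ _ (fun _ p => p.[1])) // hornerD hornerN.
  by rewrite hornerM lin1 hornerXn expr1n; ring.
Qed.

Lemma len_diff r P Q (N : rat -> int) E :
  (forall b, b \in r -> Q b = P b + (N b)%:P + lin b * E b) ->
  \sum_(b <- r) N b = 0 ->
  weight r Q = weight r P + \sum_(b <- r) (denq b - numq b) * (E b).[1].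
Proof.
move=> hQ N0.
transitivity (\sum_(b <- r) ((P b).[1] + N b + (denq b - numq b) * (E b).[1])).
  apply: eq_big_seq => b br.
  by rewrite hQ // !hornerD hornerC hornerM lin1.
by rewrite !big_split /= N0 addr0.
Qed.

(** Connectedness under exchanges, as an induction principle. The induction runs on the sum of the
    absolute values of the coefficients of all [E b], which one exchange at a leading term lowers by
    1. *)
Lemma rep_ind r x (H : int -> Prop) : admissible r ->
  (forall b u, b \in r -> rep r x u -> rep r x (u + (denq b - numq b)) ->
    (H u <-> H (u + (denq b - numq b)))) ->
  forall u v, rep r x u -> rep r x v -> (H u <-> H v).
Proof.
move=> gr Hstep _ _ [P cP <-] [Q cQ <-].
have [ur rpos _] := gr.
have [N [E [hE hN]]] := config_diff gr (etrans cP.2 (esym cQ.2)).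
pose nrm K (p : {poly int}) : int := \sum_(i < K) `|p`_i|.
have [K hK] : exists K, forall b, b \in r -> (size (E b) <= K)%N.
  exists (\max_(b <- r) size (E b))%N => b br.
  by rewrite (big_rem b) //= leq_maxl.
have [m] : exists m : nat, \sum_(b <- r) nrm K (E b) < m%:Z.
  by exists (absz (\sum_(b <- r) nrm K (E b))).+1; rewrite intS ltz1D abszE ler_norm.
elim: m P Q N E cP cQ hE hN hK => [|m IH] P Q N E cP cQ hE hN hK hm.
  by move: hm; rewrite ltNge sumr_ge0 // => b _; rewrite sumr_ge0.
have [E0|/allPn[b br Eb0]] := boolP (all (fun b => E b == 0) r).
  rewrite (len_diff hE hN) big1_seq ?addr0 // => b /andP[_ br].
  by rewrite (eqP (allP E0 _ br)) horner0 mulr0.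
(* Swapping [P] and [Q] negates [N] and [E]. *)
wlog lead_pos : P Q N E cP cQ hE hN hK hm Eb0 / 0 < lead_coef (E b).
  move=> IHw; have [lt0|] := ltP 0 (lead_coef (E b)); first exact: IHw hE _ _ _ _ _.
  rewrite le_eqVlt lead_coef_eq0 (negPf Eb0) /= => lt0.
  apply: iff_sym; apply: (IHw Q P (fun b => - N b) (fun b => - E b)) => //.
  - move=> a ar; rewrite hE // polyCN; ring.
  - by rewrite sumrN hN oppr0.
  - by move=> a ar; rewrite size_polyN hK.
  - apply: le_lt_trans hm; apply: ler_sum => a _; rewrite /nrm.
    by apply: ler_sum => i _; rewrite coefN normrN.
  - by rewrite oppr_eq0.
  - by rewrite lead_coefN oppr_gt0.
set k := (size (E b)).-1.
(* Since [E b] has no coefficient beyond [k], this coefficient of [Q b] is the one of [P b] plus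
   [denq b] times a leading coefficient that is at least 1. *)
have hk : denq b <= (Q b)`_k.+1.
  rewrite hE // !coefD coefC addr0 coefS_linM -/(lead_coef _).
  rewrite [(E b)`_k.+1]nth_default; last by rewrite /k; case: (size _).
  rewrite mulr0 subr0 -[leLHS]add0r lerD ?cP.1 //.
  by rewrite ler_pMr ?denq_gt0 // -gtz0_ge1.
have [cQ' eQ'] := config_down gr cQ br hk.
set Q' := upd _ _ _ in cQ' eQ'.
apply: (@iff_trans _ (H (weight r Q'))); last first.
  rewrite eQ'; apply: Hstep => //; first by exists Q'.
  by rewrite -eQ'; exists Q.
pose E' := upd E b (E b - 'X^k).
apply: (IH _ _ N E') => //.
- move=> a ar; rewrite /Q' /E' /upd; have [->|_] := eqVneq a b; last exact: hE.
  by rewrite hE //; ring.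
- move=> a ar; rewrite /E' /upd; case: ifP => _; last exact: hK.
  rewrite (leq_trans (size_polyD _ _)) // size_polyN size_polyXn geq_max hK //=.
  by rewrite /k prednK ?hK // lt0n size_poly_eq0.
- rewrite /E' (sum_upd _ _ (fun _ => nrm K)) //.
  have kK : (k < K)%N by rewrite /k prednK ?hK // lt0n size_poly_eq0.
  have -> : nrm K (E b - 'X^k) = nrm K (E b) - 1.
    rewrite /nrm (bigD1 (Ordinal kK)) //= [in RHS](bigD1 (Ordinal kK)) //=.
    rewrite coefB coefXn eqxx mulr1n.
    rewrite (eq_bigr (fun i : 'I_K => `|(E b)`_i|)) => [|i /eqP ik].
      have l1 : 1 <= (E b)`_k by rewrite -gtz0_ge1.
      rewrite !ger0_norm ?subr_ge0 // ?(le_trans _ l1) //; ring.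
    rewrite coefB coefXn; case: eqP => [ik'|]; last by rewrite subr0.
    by case: ik; apply/val_inj.
  by rewrite addrAC subrr sub0r ltrBlDr [ltRHS]addrC -intS.
Qed.

(** * Families as sums of generators *)

Definition gen (r : seq rat) (q : rat) : Prop := exists b k, b \in r /\ q = b ^+ k.

Lemma seq_config r s : uniq r -> (forall q, q \in s -> gen r q) ->
  rep r (\sum_(q <- s) q) (size s)%:Z.
Proof.
move=> ur; elim: s => [_|q s IH hs].
  exists (fun _ => 0); first split=> [b k|].
  - by rewrite coef0.
  - by rewrite big_nil /value big1 // => b _; rewrite evqC.
  - by rewrite /weight big1 // => b _; rewrite horner0.
have [|P [P0 Ps] lP] := IH; first by move=> c cs; apply: hs; rewrite inE cs orbT.
have [b [k [br ->]]] := hs q (mem_head _ _).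
exists (upd P b (P b + 'X^k)); first split=> [a j|].
- rewrite /upd; case: ifP => _ //; rewrite coefD coefXn addr_ge0 //.
- by rewrite /value sum_upd // -/(value r P) Ps big_cons
     evqD evqXn addrAC subrr add0r addrC.
- rewrite /weight (sum_upd _ _ (fun _ p => p.[1])) // -/(weight r P) lP hornerD hornerXn.
  by rewrite expr1n addrAC subrr add0r addrC -intS.
Qed.

Lemma poly_seq b (p : {poly int}) : (forall k, 0 <= p`_k) ->
  exists s : seq rat, [/\ forall q, q \in s -> exists k, q = b ^+ k,
    \sum_(q <- s) q = evq b p & (size s)%:Z = p.[1]].
Proof.
elim/poly_ind: p => [_|p c IH hp].
  by exists [::]; split=> //; rewrite ?big_nil ?evqC ?horner0.
have [|s [hs sum_s size_s]] := IH.
  by move=> k; have := hp k.+1; rewrite coefD coefC addr0 coefMX.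
have c0 : 0 <= c by have := hp 0; rewrite coefD coefC coefMX add0r.
(* Horner's scheme: the list for [p] is scaled by [b], and [c] copies of [1 = b ^+ 0] are put in
   front. *)
exists (nseq `|c|%N 1 ++ map ( *%R b) s); split.
- move=> q; rewrite mem_cat => /orP[|/mapP[t /hs[k ->] ->]].
    by move/nseqP => [-> _]; exists 0.
  by exists k.+1; rewrite exprS.
- rewrite big_cat /= big_nseq iter_addr_0 big_map -mulr_sumr sum_s.
  by rewrite evqD evqM evqX evqC mulrC addrC -[in RHS](gez0_abs c0).
- by rewrite size_cat size_nseq size_map PoszD gez0_abs // size_s !hornerE addrC.
Qed.

Lemma config_seq r x P : config r x P ->
  exists s : seq rat, [/\ forall q, q \in s -> gen r q,
    \sum_(q <- s) q = x & (size s)%:Z = weight r P].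
Proof.
move=> [P0 <-]; rewrite /value /weight; elim: r => [|b r [s [hs sum_s size_s]]].
  by exists [::]; rewrite !big_nil.
have [t [ht sum_t size_t]] := poly_seq b (P0 b).
exists (t ++ s); rewrite !big_cons big_cat /= sum_t sum_s size_cat PoszD size_t size_s.
split=> // q; rewrite mem_cat => /orP[/ht[k ->]|/hs[a [k [ar ->]]]].
  by exists b, k; rewrite mem_head.
by exists a, k; rewrite inE ar orbT.
Qed.

Lemma repP r x u : uniq r -> rep r x u <->
  exists s : seq rat, [/\ forall q, q \in s -> gen r q,
    \sum_(q <- s) q = x & (size s)%:Z = u].
Proof.
move=> ur; split=> [[P cP <-]|[s [hs <- <-]]]; first exact: config_seq.
exact: seq_config.
Qed.

Lemma M_P (B : {fset rat}) x :
  M_ B x <-> exists2 s : seq rat, forall q, q \in s -> gen B q & \sum_(q <- s) q = x.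
Proof.
split=> [hx|[s hs <-]].
  apply: (hx [set y | exists2 s : seq rat, forall q, q \in s -> gen B q &
                        \sum_(q <- s) q = y]); split; first split.
  - by exists [::]; rewrite ?big_nil.
  - move=> _ _ [s hs <-] [t ht <-]; exists (s ++ t); rewrite ?big_cat // => q.
    by rewrite mem_cat => /orP[/hs|/ht].
  - move=> q gq; exists [:: q]; rewrite ?big_seq1 // => c.
    by rewrite inE => /eqP ->.
move=> M [[M0 MD] MG]; elim: s hs => [|q s IH] hs; first by rewrite big_nil.
rewrite big_cons; apply: MD; first by apply/MG/hs/mem_head.
by apply: IH => c cs; apply: hs; rewrite inE cs orbT.
Qed.

(** * The atoms of the monoid *)

(* A negative coefficient of e would force all the higher ones to be negative. *)
Lemma carry_ge0 b (p f e : {poly int}) (N : int) :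
  0 < numq b -> p = f + N%:P + lin b * e ->
  (forall k, 0 <= p`_k) -> (forall k, f`_k.+1 < denq b) ->
  forall j, 0 <= e`_j.
Proof.
move=> n0 def_p p0 fd j; rewrite leNgt; apply/negP => ej.
suff /(_ (size e)) : forall i, e`_(j + i) < 0.
  by rewrite nth_default ?ltxx // leq_addl.
elim=> [|i IH]; first by rewrite addn0.
rewrite addnS ltNge; apply/negP => e'.
have d0 := denq_gt0 b; have := p0 (j + i).+1; apply/negP; rewrite -ltNge.
rewrite def_p !coefD coefC coefS_linM /= addr0.
have := fd (j + i)%N; move: IH e' n0 d0; clear.
move: f`_ _ e`_ _ e`_ _ (denq b) (numq b) => u v w d n; nia.
Qed.

(** This makes the powers atoms. In the family [F] with the single term ['X^k] all coefficients are
    at most 1, too small for any exchange in either direction, so a family with the same value has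
    [E = 0] and the same length. *)
Lemma rep_gen r b k u : admissible r -> b \in r -> rep r (b ^+ k) u -> u = 1.
Proof.
move=> gr br [P [P0 Px] <-]; have [ur rpos _] := gr.
pose F := upd (fun _ => 0) b 'X^k.
have vF : value r F = b ^+ k.
  rewrite /value /F sum_upd // evqXn evqC subr0 big1 ?add0r // => a _.
  by rewrite evqC.
have [N [E [hE hN]]] := config_diff gr (etrans vF (esym Px)).
have F1 a j : (F a)`_j <= 1.
  by rewrite /F /upd; case: ifP => _; rewrite ?coef0 // coefXn; case: eqP.
have E_ge0 a j : a \in r -> 0 <= (E a)`_j.
  move=> ar; have [_ n1 d1] := rpos _ ar.
  apply: carry_ge0 (lt_trans ltr01 n1) (hE _ ar) _ _ _ => // i.
  by rewrite (le_lt_trans (F1 _ _)).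
(* The constant terms are controlled only through their sum, where [N] cancels: it is at most 1 for
   [F], so subtracting a positive multiple of [numq a > 1] would make it negative for [P]. *)
have E0 a : a \in r -> (E a)`_0 = 0.
  move=> ar; have [_ n1 d1] := rpos _ ar.
  have F01 : \sum_(c <- r) (F c)`_0 <= 1.
    rewrite /F (sum_upd _ _ (fun _ p => p`_0)) // big1 => [|c _].
      by rewrite coef0 subr0 add0r coefXn; case: eqP.
    by rewrite coef0.
  have : 0 <= \sum_(c <- r) (P c)`_0 by apply: sumr_ge0.
  under eq_big_seq => c cr do rewrite hE // !coefD coefC eqxx coef0_linM.
  rewrite !big_split /= hN addr0 [X in _ + X](big_rem a) //=.
  have : \sum_(c <- rem a r) - (numq c * (E c)`_0) <= 0.
    rewrite big_seq sumr_le0 // => c; rewrite mem_rem_uniq // inE => /andP[_ cr].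
    have [_ nc _] := rpos _ cr; rewrite oppr_le0 mulr_ge0 ?E_ge0 //; lia.
  move: F01 (E_ge0 a 0 ar) n1; move: (\sum_(_ <- _) _) (\sum_(_ <- _) _).
  by move: (E a)`_0 (numq a) => e n s t; clear; nia.
(* Upwards in the degree: once coefficient [j] of [E a] vanishes, a positive next one would make
   coefficient [j.+1] of [P a] negative. *)
have {}E0 a : a \in r -> E a = 0.
  move=> ar; have [_ n1 d1] := rpos _ ar; apply/polyP; elim=> [|j IH].
    by rewrite E0 // coef0.
  have := P0 a j.+1; rewrite hE // !coefD coefC coefS_linM IH !coef0 /=.
  rewrite mulr0 addr0 sub0r; move: (F1 a j.+1) (E_ge0 a j.+1 ar) n1.
  by move: (F a)`_ _ (E a)`_ _ (numq a) => f e n; clear; nia.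
rewrite (len_diff hE hN) big1_seq => [|a /andP[_ ar]]; last first.
  by rewrite E0 // horner0 mulr0.
rewrite /weight /F (sum_upd _ _ (fun _ p => p.[1])) // big1 => [|a _].
  by rewrite hornerXn expr1n horner0; ring.
by rewrite horner0.
Qed.

Lemma gen_gt0 r q : admissible r -> gen r q -> 0 < q.
Proof. by move=> [_ rpos _] [b [k [/rpos[b0 _ _] ->]]]; rewrite exprn_gt0. Qed.

(** In a sum of generators that is an atom, the terms after the first must add up to 0. Conversely,
    splitting a power into two nonzero elements would give it a length of at least 2, against
    [rep_gen]. *)
Lemma atomP (B : {fset rat}) a : admissible B -> atom (M_ B) a <-> gen B a.
Proof.
move=> gB; split=> [[/M_P[s hs <-] s0 irr]|ga].
  case: s hs s0 irr => [|q s] hs; first by rewrite big_nil eqxx.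
  have gq : gen B q by apply: hs; rewrite mem_head.
  rewrite big_cons => s0 irr.
  have [->|t0] := eqVneq (\sum_(c <- s) c) 0; first by rewrite addr0.
  case: irr; exists q, (\sum_(c <- s) c); split=> //;
    last by rewrite gt_eqF // (gen_gt0 gB).
    by apply/M_P; exists [:: q]; rewrite ?big_seq1 // => c; rewrite inE => /eqP ->.
  by apply/M_P; exists s => // c cs; apply: hs; rewrite inE cs orbT.
split; last 2 first.
- by rewrite gt_eqF // (gen_gt0 gB).
- move=> [y [z [/M_P[s hs ys] /M_P[t ht zt] y0 z0 ayz]]].
  have [b [k [bB ak]]] := ga.
  have /(rep_gen gB bB) : rep B (b ^+ k) (size (s ++ t))%:Z.
    rewrite -ak ayz -ys -zt -big_cat; apply: seq_config; first by case: gB.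
    by move=> q; rewrite mem_cat => /orP[/hs|/ht].
  rewrite size_cat => -[].
  case: s ys {hs} => [|c s] ys; first by rewrite -ys big_nil eqxx in y0.
  case: t zt {ht} => [|e t] zt; first by rewrite -zt big_nil eqxx in z0.
  by rewrite addnS.
by apply/M_P; exists [:: a]; rewrite ?big_seq1 // => c; rewrite inE => /eqP ->.
Qed.

Lemma L_E (B : {fset rat}) x : admissible B ->
  L_ (M_ B) x = [set n : nat | rep B x n%:Z].
Proof.
move=> gB; have [uB _ _] := gB; apply/seteqP; split=> n /=.
  move=> [z [hz <-] <-]; apply/repP => //; exists z; split=> // q /hz.
  by move/(atomP _ gB).
move=> /repP-/(_ uB)[s [hs <- [<-]]].
exists (seq_mset s); last by rewrite (perm_size (perm_eq_seq_mset _)).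
split; last by rewrite (perm_big _ (perm_eq_seq_mset _)).
by move=> a; rewrite (perm_mem (perm_eq_seq_mset _)) => /hs /(atomP _ gB).
Qed.

(** * Arithmetic progressions in one and several dimensions *)

Definition AP_of (m d : nat) (l : option nat) : set nat :=
  [set s | exists2 p, P_ l d p & s = (m + p)%N].

Lemma P_0 l d : P_ l d 0.
Proof. by split; [exact: dvdn0 | case: l]. Qed.

(** The minimum of [S] is the start. If [S] is bounded, its maximum gives the number of steps;
    otherwise every larger member of the residue class lies below some element of [S]. *)
Lemma interval_AP (S : set nat) (d : nat) : (0 < d)%N -> S !=set0 ->
  (forall s t, S s -> S t -> (s <= t)%N ->
    (d %| t - s)%N /\
    forall u, (s <= u <= t)%N -> (d %| u - s)%N -> S u) ->
  exists m l, S = AP_of m d l.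
Proof.
move=> d0 [s0 Ss0] hS.
have exS : exists n, `[< S n >] by exists s0; apply/asboolP.
case: (ex_minnP exS) => m /asboolP Sm minm.
have {}minm s : S s -> (m <= s)%N by move=> /asboolP; exact: minm.
have [[N hN]|unbounded] := pselect (exists N, forall s, S s -> (s <= N)%N).
  have leN i : `[< S i >] -> (i <= N)%N by move=> /asboolP /hN.
  case: (ex_maxnP exS leN) => M /asboolP SM maxM.
  have {}maxM s : S s -> (s <= M)%N by move=> /asboolP; exact: maxM.
  have [/dvdnP[q hq] hM] := hS _ _ Sm SM (minm _ SM).
  exists m, (Some q); apply/seteqP; split=> s /=.
    move=> Ss; have [ds _] := hS _ _ Sm Ss (minm _ Ss).
    exists (s - m)%N; last by rewrite subnKC // minm.
    by split=> //; rewrite -hq leq_sub2r // maxM.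
  move=> [p [dp pq] ->]; apply: hM; rewrite ?addKn // leq_addr /=.
  by rewrite -leq_subRL ?minm // hq.
exists m, None; apply/seteqP; split=> s /=.
  move=> Ss; have [ds _] := hS _ _ Sm Ss (minm _ Ss).
  by exists (s - m)%N; [split | rewrite subnKC // minm].
move=> [p [dp _] ->].
have [t St pt] : exists2 t, S t & (m + p <= t)%N.
  apply/not_exists2P => h; apply: unbounded; exists (m + p)%N => t St.
  by case: (h t) => // /negP; rewrite -ltnNge => /ltnW.
have [_ h] := hS _ _ Sm St (minm _ St).
by apply: h; rewrite ?addKn // leq_addr.
Qed.

Lemma multi_AP_sum (T : choiceType) (r : seq T) c m d l : uniq r ->
  (forall b, b \in r -> (0 < d b)%N) ->
  multi_AP (size r) [set s | exists t : T -> nat,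
    (forall b, b \in r -> AP_of (m b) (d b) (l b) (t b)) /\
    s = (c + \sum_(b <- r) t b)%N].
Proof.
case: r => [|b0 r'] ur d0.
  (* Dimension 0: the set is the singleton of [c]. *)
  exists c, (fun=> 1%N), (fun=> None); split=> [|//|].
    split; first by exists (fun=> 0%N); rewrite big_nil addn0.
    by move=> s [t [_ ->]]; rewrite leq_addr.
  apply/seteqP; split=> s /=.
    by move=> [t [_ ->]]; exists (fun=> 0%N); split; [case | rewrite big_nil big_ord0].
  by move=> [p [_ ->]]; exists (fun=> 0%N); rewrite big_nil big_ord0.
set r := b0 :: r' in ur d0 *.
pose e (i : 'I_(size r)) := nth b0 r i.
have er i : e i \in r by rewrite mem_nth.
have sumE (F : T -> nat) : (\sum_(b <- r) F b = \sum_i F (e i))%N.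
  by rewrite (big_nth b0) big_mkord.
exists (c + \sum_(b <- r) m b)%N, (d \o e), (l \o e); split=> [|i|].
- split.
    exists m; split=> // b br; exists 0; [exact: P_0 | by rewrite addn0].
  move=> s [t [ht ->]]; rewrite leq_add2l big_seq [leqRHS]big_seq.
  by apply: leq_sum => b /ht[p _ ->]; rewrite leq_addr.
- exact: d0.
- apply/seteqP; split=> s /=.
    move=> [t [ht ->]]; exists (fun i => t (e i) - m (e i))%N; split=> [i|].
      by have [p hp ->] := ht _ (er i); rewrite addKn.
    rewrite -addnA; congr (_ + _)%N; rewrite !sumE -big_split /=.
    apply: eq_bigr => i _; have [p hp ->] := ht _ (er i).
    by rewrite addKn.
  move=> [p [hp ->]].
  (* [p] lives on the positions in [r]; elements outside [r] get the default 0. *)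
  pose t b := (m b + oapp p 0 (insub (index b r)))%N.
  have te i : t (e i) = (m (e i) + p i)%N.
    rewrite /t /e index_uniq //; case: insubP => [j _ ji|]; last by rewrite ltn_ord.
    by rewrite /= (_ : j = i) //; apply/val_inj.
  exists t; split=> [b br|].
    have bi : (index b r < size r)%N by rewrite index_mem.
    have <- : e (Ordinal bi) = b by rewrite /e nth_index.
    by rewrite te; exists (p (Ordinal bi)) => //; exact: hp.
  rewrite -addnA; congr (_ + _)%N; rewrite !sumE -big_split.
  by apply: eq_bigr => i _; rewrite te.
Qed.

Lemma arithmetic_progression_AP_of m d l : (0 < d)%N ->
  arithmetic_progression (AP_of m d l).
Proof.
move=> d0.
have := @multi_AP_sum nat [:: 0%N] 0 (fun=> m) (fun=> d) (fun=> l) isT (fun _ _ => d0).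
rewrite /arithmetic_progression; congr multi_AP; apply/seteqP; split=> s /=.
  by move=> [t [ht ->]]; rewrite add0n big_seq1; apply: ht; rewrite mem_head.
by move=> hs; exists (fun=> s); rewrite big_seq1.
Qed.

(** * Exchanges with a common step size *)

Lemma rep_AP r x (d : nat) : admissible r -> (0 < d)%N ->
  (forall b, b \in r -> `|denq b - numq b| = d%:Z) ->
  [set n : nat | rep r x n%:Z] !=set0 ->
  exists m l, [set n : nat | rep r x n%:Z] = AP_of m d l.
Proof.
move=> gr d0 hd S0; apply: interval_AP => // s t /= hs ht st.
(* Every step crosses at most one element of the class of s modulo d. *)
pose H (v : int) := (d%:Z %| v - s%:Z)%Z /\
  forall u : int, (s%:Z <= u <= v) || (v <= u <= s%:Z) ->
    (d%:Z %| u - s%:Z)%Z -> rep r x u.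
have Hstep u w : `|w - u| = d%:Z -> rep r x w -> H u -> H w.
  move=> uw rw [/dvdzP[q hq] hu]; split.
    apply/dvdzP; have [h|h] : w - u = d%:Z \/ w - u = - d%:Z by lia.
      by exists (q + 1); lia.
    by exists (q - 1); lia.
  (* Either [v] is already covered by [H u], or it is the one new member of the class, [w]. *)
  move=> v hv dv; have [|nv] := boolP ((s%:Z <= v <= u) || (u <= v <= s%:Z)).
    by move=> hv'; exact: hu.
  suff -> : v = w by [].
  move/dvdzP: dv => [q' hq'].
  have e : v - u = (q' - q) * d%:Z by lia.
  have [h|h] : w - u = d%:Z \/ w - u = - d%:Z by lia.
    have : q' - q = 1 by nia.
    move=> h1; rewrite h1 in e; lia.
  have : q' - q = -1 by nia.
  move=> h1; rewrite h1 in e; lia.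
have Hs : H s.
  split; first by rewrite subrr dvdz0.
  by move=> u /orP[] hu _; rewrite (_ : u = s) //; lia.
have [dt ivt] : H t.
  apply/(rep_ind gr _ hs ht) => // b u br ru rv.
  split; apply: Hstep => //; last by rewrite opprD addNKr normrN hd.
  by rewrite [u + _]addrC addrK hd.
split; first by rewrite subzn in dt.
move=> u /andP[su ut] du; apply: ivt; last by rewrite subzn.
by rewrite !lez_nat su ut.
Qed.

(** * The set of lengths as a finite union *)

Lemma evq_ge0 b (p : {poly int}) : 0 <= b -> (forall k, 0 <= p`_k) -> 0 <= evq b p.
Proof.
move=> b0 p0; rewrite /evq horner_coef; apply: sumr_ge0 => i _.
by rewrite coef_map mulr_ge0 ?exprn_ge0 // ler0z.
Qed.

Lemma horner1_le_evq b (p : {poly int}) : 1 <= b -> (forall k, 0 <= p`_k) ->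
  p.[1]%:~R <= evq b p.
Proof.
move=> b1 p0; rewrite /evq (@horner_coef_wide _ (size p) (map_poly intr p)) ?size_poly //.
rewrite horner_coef rmorph_sum /=; apply: ler_sum => i _.
by rewrite coef_map expr1n mulr1 ler_peMr ?ler0z // exprn_ege1.
Qed.

Lemma admissible1 r b : admissible r -> b \in r -> admissible [:: b].
Proof.
move=> [_ rpos _] br; split=> // [a|a a']; rewrite !inE;
  first by move/eqP ->; exact: rpos.
by move=> /eqP -> /eqP ->; rewrite eqxx.
Qed.

(** Multiplication by ['X] turns a representation of [y b] into one of [b * y b] of the same length;
    the constant [c] is stored at [b0]. *)
Lemma rep_join r x (c : nat) (y : rat -> rat) (t : rat -> nat) b0 :
  uniq r -> b0 \in r -> c%:R + \sum_(b <- r) b * y b = x ->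
  (forall b, b \in r -> rep [:: b] (y b) (t b)) ->
  rep r x (c + \sum_(b <- r) t b)%N.
Proof.
move=> ur br <- ht.
have /choice[q hq] : forall b, exists q : {poly int}, (forall k, 0 <= q`_k) /\
    (b \in r -> evq b q = y b /\ q.[1] = t b).
  move=> b; case: (boolP (b \in r)) => [/ht[Q [Q0 Qy] Qt]|_]; last first.
    by exists 0; split=> // k; rewrite coef0.
  exists (Q b); split=> // _; split; first by rewrite -Qy /value big_seq1.
  by rewrite -Qt /weight big_seq1.
have q0 b := (hq b).1.
pose P b := q b * 'X.
exists (upd P b0 (P b0 + c%:Z%:P)); first split.
- move=> b k; rewrite /upd /P; case: ifP => _.
    by rewrite coefD coefMX coefC; case: k => [|k] /=; rewrite ?add0r ?addr0.
  by rewrite coefMX; case: k => [|k] /=; rewrite ?lexx.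
- rewrite /value sum_upd // evqD evqC addrAC subrr add0r addrC; congr (_ + _).
  apply: eq_big_seq => b /(hq b).2[hy _].
  by rewrite /P evqM evqX hy mulrC.
- rewrite /weight (sum_upd _ _ (fun _ p => p.[1])) // hornerD hornerC addrAC subrr.
  rewrite add0r addrC PoszD; congr (_ + _).
  rewrite (big_morph Posz PoszD (erefl _)); apply: eq_big_seq => b /(hq b).2[_ h1].
  by rewrite /P hornerMX mulr1 h1.
Qed.

(** Empty members are discarded first, as a progression is nonempty. *)
Lemma finite_union_of_finType (C : set nat -> Prop) (T : finType) (A : T -> set nat) :
  (forall i, A i !=set0 -> C (A i)) -> finite_union_of C (\bigcup_i A i).
Proof.
move=> hA; pose s := [seq i <- enum T | `[< A i !=set0 >]].
have sA i : i \in s -> A i !=set0 by rewrite mem_filter => /andP[/asboolP].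
exists (size s), (fun j => A (tnth (in_tuple s) j)); split=> [j|].
  by apply/hA/sA; rewrite mem_tnth.
apply/seteqP; split=> n [i _ Ain]; last by exists (tnth (in_tuple s) i).
have si : i \in s by rewrite mem_filter mem_enum inE andbT; apply/asboolP; exists n.
by have /tnthP[j ij] : i \in in_tuple s by []; exists j => //; rewrite -ij.
Qed.

Lemma absz_den_num_gt0 r b : admissible r -> b \in r -> (0 < `|denq b - numq b|)%N.
Proof.
move=> [_ rpos _] /rpos[b0 n1 d1]; rewrite absz_gt0 subr_eq0; apply/eqP => e.
have := coprime_num_den b; rewrite -e /coprime gcdnn => /eqP; lia.
Qed.

Lemma evq_le_value r x P b : admissible r -> config r x P -> b \in r -> evq b (P b) <= x.
Proof.
move=> [ur rpos _] [P0 <-] br; rewrite /value (big_rem b) //= lerDl.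
rewrite big_seq sumr_ge0 // => a; rewrite mem_rem_uniq // inE => /andP[_ ar].
by have [a0 _ _] := rpos _ ar; rewrite evq_ge0 // ltW.
Qed.

Lemma take_poly1 (p : {poly int}) : take_poly 1 p = (p`_0)%:P.
Proof. by apply/polyP => -[|i]; rewrite coef_take_poly coefC. Qed.

Lemma rep_finite_union r x b0 : admissible r -> b0 \in r -> (exists u, rep r x u) ->
  finite_union_of multidimensional_AP [set n : nat | rep r x n%:Z].
Proof.
move=> gr br [u0 [P0 cP0 _]]; have [ur rpos _] := gr.
(* The value at [b] of the polynomial left after removing the constant term and dividing by ['X]. *)
pose w P (b : rat) := evq b (drop_poly 1 (P b)).
have wE P b : evq b (P b) = ((P b)`_0)%:~R + b * w P b.
  rewrite -{1}(poly_take_drop 1 (P b)) evqD evqM evqX mulrC; by rewrite take_poly1 evqC.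
pose K := Num.bound `|x|.
have xK : x < K%:R by rewrite (le_lt_trans (ler_norm x)) // archi_boundP.
have w0 P b : config r x P -> b \in r -> 0 <= b * w P b.
  move=> [P_ge0 _] /rpos[/ltW b_ge0 _ _]; rewrite mulr_ge0 // evq_ge0 // => k.
  by rewrite coef_drop_poly.
have P_le P b : config r x P -> b \in r -> b * w P b <= x.
  move=> cP bbr; apply: le_trans (evq_le_value gr cP bbr).
  by rewrite wE lerDr ler0z cP.1.
have c_le P : config r x P -> \sum_(b <- r) (P b)`_0 < K%:Z.
  move=> cP; rewrite -(ltr_int rat) (le_lt_trans _ xK) // -cP.2 rmorph_sum /=.
  rewrite /value big_seq [leRHS]big_seq; apply: ler_sum => b bbr.
  by rewrite wE lerDl w0.
pose n := (K + K)%N.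
(* An index [f] encodes integer shifts in [[-K, K]], moved by [K] to be natural numbers, of the
   products [b * w P0 b]. In [A], the component [i.1] is the sum of the constant terms. *)
pose y (f : (size r).-tuple 'I_n.+1) b :=
  w P0 b + ((nth ord0 f (index b r))%:R - K%:R) / b.
pose A (i : 'I_n.+1 * (size r).-tuple 'I_n.+1) := [set s : nat |
  (i.1%:R + \sum_(b <- r) b * y i.2 b = x) /\
  exists t : rat -> nat, (forall b, b \in r -> rep [:: b] (y i.2 b) (t b)) /\
    s = (i.1 + \sum_(b <- r) t b)%N].
have -> : [set n : nat | rep r x n%:Z] = \bigcup_i A i.
  apply/seteqP; split=> s /=; last first.
    by move=> [i _ [hx [t [ht ->]]]]; exact: rep_join br hx ht.
  move=> [P cP sP].
  have [N [E [hE _]]] := config_diff gr (etrans cP0.2 (esym cP.2)).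
  (* The integer by which [b * w P b] exceeds [b * w P0 b]; both products lie between 0 and
     [x < K]. *)
  pose Z b := N b - (P b)`_0 + (P0 b)`_0.
  have wZ b : b \in r -> b * w P b = b * w P0 b + (Z b)%:~R.
    move=> bbr; have := wE P b; rewrite hE // evqD evqD evqM evq_lin mul0r addr0.
    rewrite evqC wE -hE // => e; rewrite /Z rmorphD rmorphB /=.
    by apply/eqP; rewrite -subr_eq0; move/eqP: e; rewrite -subr_eq0; lra.
  have ZK b : b \in r -> - K%:Z <= Z b <= K%:Z.
    move=> bbr; rewrite -!(ler_int rat) rmorphN /=.
    have := wZ b bbr; have := w0 P b cP bbr; have := w0 P0 b cP0 bbr.
    have := P_le P b cP bbr; have := P_le P0 b cP0 bbr; move: xK.
    rewrite -[K%:R]/(K%:~R); lra.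
  pose f := map_tuple (fun b => inord (absz (Z b + K%:Z)) : 'I_n.+1) (in_tuple r).
  have yE b : b \in r -> y f b = w P b.
    move=> bbr; have [/lt0r_neq0 b_neq0 _ _] := rpos _ bbr.
    have bi : (index b r < size r)%N by rewrite index_mem.
    rewrite /y /f /= (nth_map b) // nth_index // inordK; last first.
      by rewrite /n; have := ZK b bbr; lia.
    have -> : (absz (Z b + K%:Z))%:R = (Z b)%:~R + K%:R :> rat.
      by rewrite natr_absz ger0_norm ?rmorphD //; have := ZK b bbr; lia.
    by rewrite addrK; apply: (mulfI b_neq0); rewrite mulrDr wZ // [X in _ + X]mulrC divfK.
  have c0 : 0 <= \sum_(b <- r) (P b)`_0 by apply: sumr_ge0 => b _; exact: cP.1.
  have cE : (inord (absz (\sum_(b <- r) (P b)`_0)) : 'I_n.+1) =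
      absz (\sum_(b <- r) (P b)`_0) :> nat.
    rewrite inordK // ltnS /n; move: c0 (c_le P cP).
    by move: (\sum_(_ <- _) _) => c; lia.
  exists (inord (absz (\sum_(b <- r) (P b)`_0)), f) => //; split=> /=.
    rewrite cE natr_absz ger0_norm // rmorph_sum -big_split -cP.2 /=.
    by apply: eq_big_seq => b bbr; rewrite yE // wE.
  exists (fun b => absz (drop_poly 1 (P b)).[1]).
  have drop1_ge0 b : 0 <= (drop_poly 1 (P b)).[1].
    rewrite horner_coef; apply: sumr_ge0 => i _.
    by rewrite expr1n mulr1 coef_drop_poly cP.1.
  split=> [b bbr|].
    exists (fun=> drop_poly 1 (P b)); last by rewrite /weight big_seq1 gez0_abs.
    by split=> [_ k|]; rewrite ?coef_drop_poly ?cP.1 // /value big_seq1 yE.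
  rewrite cE; apply/eqP; rewrite -eqz_nat -sP PoszD gez0_abs //.
  rewrite (big_morph Posz PoszD (erefl _)) -big_split; apply/eqP/eq_bigr => b _ /=.
  rewrite gez0_abs // -{1}(poly_take_drop 1 (P b)) hornerD hornerM hornerX mulr1.
  by rewrite take_poly1 hornerC.
apply: finite_union_of_finType => i [s0 [hx [t0 [ht0 _]]]].
(* For a single [b] all exchanges have the same step size, so [rep_AP] applies; [A i] is the
   translated sumset of these progressions. *)
have /choice[ml hml] : forall b, exists ml : nat * option nat, b \in r ->
    [set s : nat | rep [:: b] (y i.2 b) s] = AP_of ml.1 `|denq b - numq b|%N ml.2.
  move=> b; case: (boolP (b \in r)) => bbr; last by exists (0%N, None).
  have [||||m [l e]] := @rep_AP [:: b] (y i.2 b) `|denq b - numq b|%N.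
  - exact: admissible1 bbr.
  - exact: absz_den_num_gt0 gr bbr.
  - by move=> a; rewrite inE => /eqP ->; rewrite abszE.
  - by exists (t0 b); apply: ht0.
  by exists (m, l).
exists (size r); split.
  by rewrite (leq_ltn_trans _ (_ : (index b0 r < size r)%N)) ?index_mem.
have -> : A i = [set s | exists t : rat -> nat,
    (forall b, b \in r -> AP_of (ml b).1 `|denq b - numq b|%N (ml b).2 (t b)) /\
    s = (i.1 + \sum_(b <- r) t b)%N].
  apply/seteqP; split=> s /=.
    move=> [_ [t [ht ->]]]; exists t; split=> // b bbr.
    by rewrite -hml //; exact: ht.
  move=> [t [ht ->]]; split=> //; exists t; split=> // b bbr.
  by have := ht b bbr; rewrite -hml.
apply: multi_AP_sum => // b bbr; exact: absz_den_num_gt0 gr bbr.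
Qed.

(** * Bounded and unbounded lengths *)

(** Termwise in [b]. For [b >= 1] the length of [P b] is at most its value. For [b < 1], [carry_ge0]
    applied in both directions gives [E b = 0], so the lengths of [P b] and [F b] differ by [N b],
    which is at most the value of [P b]. *)
Lemma weight_bound r x P F : admissible r -> config r x P -> config r x F ->
  (forall b Q k, b \in r -> b < 1 -> config r x Q -> (Q b)`_k.+1 < denq b) ->
  (weight r P)%:~R <= (weight r F)%:~R + x.
Proof.
move=> gr cP cF stuck; have [ur rpos _] := gr.
have [N [E [hE _]]] := config_diff gr (etrans cF.2 (esym cP.2)).
rewrite -[leRHS](congr2 +%R (erefl _) cP.2) /weight /value !rmorph_sum -big_split /=.
rewrite big_seq [leRHS]big_seq; apply: ler_sum => b br.
have [b0 n1 _] := rpos _ br.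
have F1 : 0 <= (F b).[1].
  by rewrite horner_coef sumr_ge0 // => i _; rewrite expr1n mulr1 cF.1.
have [b1|b1] := ltP b 1; last first.
  by apply: le_trans (horner1_le_evq b1 (cP.1 b)) _; rewrite lerDr ler0z.
have E0 : E b = 0.
  have n0 := lt_trans ltr01 n1.
  have [sP sF] := (fun k => stuck b P k br b1 cP, fun k => stuck b F k br b1 cF).
  have Ege := carry_ge0 n0 (hE b br) (cP.1 b) sF.
  have hE' : F b = P b + (- N b)%:P + lin b * - E b.
    by rewrite hE // polyCN; ring.
  have Ele := carry_ge0 n0 hE' (cF.1 b) sP.
  apply/polyP => j; rewrite coef0; apply/eqP; rewrite eq_le Ege andbT.
  by rewrite -oppr_ge0 -coefN Ele.
have := hE b br; rewrite E0 mulr0 addr0 => {hE}hb.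
have FN : (P b).[1] = (F b).[1] + N b by rewrite hb hornerD hornerC.
have : evq b (P b) = evq b (F b) + (N b)%:~R by rewrite hb evqD evqC.
have := evq_ge0 (ltW b0) (cF.1 b); rewrite FN rmorphD /= lerD2l; lra.
Qed.

Lemma natr_num (b : rat) : 0 < b -> (num b)%:R = (numq b)%:~R :> rat.
Proof. by move=> b0; rewrite natr_absz gtr0_norm // numq_gt0. Qed.

Lemma M_P_rep (B : {fset rat}) x : M_ B x <-> exists u, rep B x u.
Proof.
split=> [/M_P[s hs <-]|[u [P cP _]]].
  by exists (size s); apply: seq_config => //; exact: fset_uniq.
by have [s [hs sx _]] := config_seq cP; apply/M_P; exists s.
Qed.

Lemma M_gen (B : {fset rat}) b k n : b \in B -> M_ B (n%:R * b ^+ k).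
Proof.
move=> bB; apply/M_P; exists (nseq n (b ^+ k)).
  by move=> q /nseqP[-> _]; exists b, k.
by rewrite big_nseq iter_addr_0 mulr_natl.
Qed.

(** Removing [den b] copies of [b ^+ k.+1], which add up to [num b] copies of [b ^+ k], leaves a
    valid family. *)
Lemma divides_of_config (B : {fset rat}) x P b k : admissible B -> b \in B ->
  config B x P -> denq b <= (P b)`_k.+1 ->
  divides_in (M_ B) ((num b)%:R * b ^+ k) x.
Proof.
move=> gB bB cP hk; have [uB rpos _] := gB; have [b0 _ _] := rpos _ bB.
split; first exact: M_gen.
  by apply/M_P_rep; exists (weight B P), P.
pose p := P b - (denq b)%:P * 'X^(k.+1).
exists (x - (num b)%:R * b ^+ k); last by rewrite addrC subrK.
apply/M_P_rep; exists (weight B (upd P b p)), (upd P b p) => //; split=> [a j|].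
  rewrite /upd; case: ifP => _; last exact: cP.1.
  rewrite coefB coefCM coefXn; case: eqP => [->|_]; last by rewrite mulr0 subr0 cP.1.
  by rewrite mulr1 subr_ge0.
rewrite /value sum_upd // -/(value B P) cP.2 evqB evqM evqC evqXn; congr (_ + _).
rewrite addrAC subrr sub0r exprS mulrA [_ * b]mulrC denq_rat natr_num //.
Qed.

Lemma long_reps (B : {fset rat}) x b l : admissible B -> b \in B -> b < 1 ->
  divides_in (M_ B) ((num b)%:R * b ^+ l) x ->
  forall j : nat, exists n : nat, (j <= n)%N /\ rep B x n%:Z.
Proof.
move=> gB bB b1 [_ _ [y /M_P[s0 hs0 <-] xE]] j.
have [uB rpos _] := gB; have [b0 n1 _] := rpos _ bB.
have nd : (num b < den b)%N.
  rewrite /num /den -ltz_nat !gtz0_abs ?numq_gt0 ?denq_gt0 //.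
  rewrite -(ltr_int rat) -denq_rat -[ltRHS]mul1r ltr_pM2r // ltr0z denq_gt0 //.
(* After [j] expansions [num b] copies of [b ^+ (l + j)] are set aside for the next one; each
   expansion adds [den b - num b > 0] terms to [s]. *)
have [s [hs xs js]] : exists s : seq rat, [/\ forall q, q \in s -> gen B q,
    (num b)%:R * b ^+ (l + j) + \sum_(q <- s) q = x & (j <= size s)%N].
  elim: j => [|j [s [hs xs js]]]; first by exists s0; rewrite addn0 -xE.
  exists (nseq (den b - num b) (b ^+ (l + j).+1) ++ s); split.
  - move=> q; rewrite mem_cat => /orP[/nseqP[-> _]|/hs //].
    by exists b, (l + j).+1.
  - rewrite -xs big_cat /= addrA; congr (_ + _).
    rewrite big_nseq iter_addr_0 addnS -[_ ^+ _ *+ _]mulr_natl.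
    rewrite -mulrDl -natrD subnKC 1?ltnW //.
    by rewrite natr_num // -denq_rat exprS /den natr_absz gtr0_norm; first ring.
  - rewrite size_cat size_nseq; lia.
exists (num b + size s)%N; split; first by rewrite (leq_trans js) ?leq_addl.
apply/repP => //; exists (nseq (num b) (b ^+ (l + j)) ++ s); split.
- move=> q; rewrite mem_cat => /orP[/nseqP[-> _]|/hs //].
  by exists b, (l + j)%N.
- by rewrite big_cat /= big_nseq iter_addr_0 -[_ ^+ _ *+ _]mulr_natl.
- by rewrite size_cat size_nseq.
Qed.

Lemma infinite_natP (S : set nat) :
  infinite_set S <-> forall N, exists n, (N <= n)%N /\ S n.
Proof.
split=> [infS N|unb /finite_seqP[s sE]].
  apply: contrapT => h; apply: infS; apply: sub_finite_set (finite_II N) => n Sn /=.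
  by rewrite ltnNge; apply/negP => Nn; apply: h; exists n.
have [n [hn]] := unb (\max_(i <- s) i).+1.
rewrite sE /= => ns; move: hn; rewrite ltnNge (big_rem n) //= leq_maxl //.
Qed.

(** * From canonical generating sets to the theorem *)

Lemma canonical_admissible (B : {fset rat}) : canonical_multicyclic B -> admissible B.
Proof.
move=> [[Bpos Bunit _] Bnat cop]; split=> [|b bB|b b' bB b'B bb'].
- exact: fset_uniq.
- have b0 := Bpos _ bB; have n0 : 0 < numq b by rewrite numq_gt0.
  have d0 := denq_gt0 b.
  have d1 : denq b != 1.
    apply/negP => /eqP d1; have /negP := Bnat _ bB; apply.
    rewrite -(divq_num_den b) d1 divr1 -(gtz0_abs n0).
    exact: natr_nat.
  have n1 : numq b != 1.
    apply/negP => /eqP n1; apply: (Bunit _ bB); exists (den b); split.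
      rewrite /den; lia.
    by rewrite -{1}(divq_num_den b) n1 mul1r /den natr_absz gtr0_norm.
  by split=> //; lia.
- by have := cop _ _ bB b'B bb'; rewrite /coprime /coprimez /gcdz /den => /eqP ->.
Qed.

Theorem theorem4p9 (B : {fset rat}) (x : rat)
    (hB : canonical_multicyclic B) (hx : M_ B x) (hx0 : x != 0) :
  (finite_union_of multidimensional_AP (L_ (M_ B) x) /\
   (infinite_set (L_ (M_ B) x) <->
    exists (b : rat) (l : nat),
      [/\ b \in B, b < 1 & divides_in (M_ B) ((num b)%:R * b ^+ l) x])) /\
  ((forall b b', b \in B -> b' \in B ->
      `|(num b)%:Z - (den b)%:Z| = `|(num b')%:Z - (den b')%:Z|) ->
   arithmetic_progression (L_ (M_ B) x)).
Proof.
have gB := canonical_admissible hB; have [uB rpos _] := gB.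
have [u0 ru0] := (M_P_rep B x).1 hx.
have [b0 b0B] : exists b0, b0 \in B.
  have [s hs sx] := (M_P B x).1 hx.
  case: s hs sx => [_ sx|q s hs _]; first by rewrite -sx big_nil eqxx in hx0.
  by have [b [k [bB _]]] := hs q (mem_head _ _); exists b.
have rep_nat u : rep B x u -> exists n : nat, u = n%:Z.
  by move/(repP _ _ uB) => [s [_ _ <-]]; exists (size s).
rewrite L_E //; split; [split; [|split]|].
- by apply: rep_finite_union b0B _ => //; exists u0.
(* Without such a divisor no family of [x] admits an exchange of [b ^+ k.+1] for [b ^+ k] with
   [b < 1], so [weight_bound] against a fixed family [F] bounds all lengths. *)
- move/infinite_natP => unb; apply: contrapT => stuck.
  have [F cF _] := ru0.
  pose K := Num.bound `|(weight B F)%:~R + x|.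
  have [n [Kn [P cP wP]]] := unb K.
  have : (weight B P)%:~R < K%:R :> rat.
    apply: le_lt_trans (le_lt_trans (ler_norm _) (archi_boundP (normr_ge0 _))).
    apply: weight_bound => // b Q k bB b1 cQ; rewrite ltNge; apply/negP => hk.
    by apply: stuck; exists b, k; split=> //; exact: divides_of_config hk.
  by rewrite wP ltr_nat ltnNge Kn.
- move=> [b [l [bB b1 bx]]]; apply/infinite_natP => N.
  exact: long_reps bB b1 bx N.
move=> hd.
have [|b bB||m [l ->]] := @rep_AP B x (absz (denq b0 - numq b0)) gB.
- exact: absz_den_num_gt0 gB b0B.
- have [[b_gt0 _ _] [b0_gt0 _ _]] := (rpos _ bB, rpos _ b0B).
  have num_pos a : 0 < a -> (num a)%:Z = numq a by rewrite -numq_gt0 => /gtz0_abs.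
  have := hd _ _ bB b0B; rewrite /den !num_pos // !(gtz0_abs (denq_gt0 _)).
  by rewrite abszE distrC => ->; rewrite distrC.
- by have [n un] := rep_nat _ ru0; exists n; rewrite /= -un.
apply: arithmetic_progression_AP_of; exact: absz_den_num_gt0 gB b0B.
Qed.
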